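(* Let $\Theta\subseteq\mathbb{R}$, let $x=(x_1,\ldots,x_n)$ be fixed observed values of i.i.d. observations with likelihood $\theta\mapsto\ell(x;\theta)$, $\theta\in\Theta$, and let $p_1(\theta),p_2(\theta)$ be two (possibly improper) prior densities on $\Theta$. Let $p_i(\theta;x)=\kappa_i(x)p_i(\theta)\ell(x;\theta)$, $i=1,2$, be the corresponding posterior probability densities, where $\kappa_i(x)$ are the normalizing constants; let $I_i=(a_i,b_i)$ be the support of $p_i(\cdot;x)$, let $P_i$ be the posterior distribution and $\Theta_i\sim P_i$. Suppose that $I_2\subseteq I_1$ and that the posterior means $\mu_1={\rm E}[\Theta_1]$ and $\mu_2={\rm E}[\Theta_2]$ are finite. Put $\rho(\theta)=p_2(\theta)/p_1(\theta)$, and let $$\tau_1(\theta;x)=\frac{1}{p_1(\theta;x)}\int_{a_1}^{\theta}(\mu_1-y)p_1(y;x)\,dy,\qquad \theta\in I_1,$$ be the Stein kernel of $P_1$. Let $\mathcal{H}$ be the set of Lipschitz-1 functions $h:\mathbb{R}\to\mathbb{R}$. Assume that $\theta\mapsto\rho(\theta)$ is differentiable on $I_2$ and satisfies: (i) ${\rm E}[|\Theta_1-\mu_1|\rho(\Theta_1)]<\infty$; (ii) for all $h\in\mathcal{H}$, the derivative $\left(\rho(\theta)\int_{a_1}^{\theta}(h(y)-{\rm E}[h(\Theta_1)])p_1(y;x)\,dy\right)'$ is integrable (on $I_2$); (iii) for all $h\in\mathcal{H}$, $\rho(\theta)\int_{a_1}^{\theta}(h(y)-{\rm E}[h(\Theta_1)])p_1(y;x)\,dy\to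 0$ as $\theta\to a_2$ and as $\theta\to b_2$. Then $$|\mu_1-\mu_2|=\frac{|{\rm E}[\tau_1(\Theta_1;x)\rho'(\Theta_1)]|}{{\rm E}[\rho(\Theta_1)]}\leq d_{\mathcal{W}}(P_1,P_2)\leq \frac{{\rm E}[\tau_1(\Theta_1;x)|\rho'(\Theta_1)|]}{{\rm E}[\rho(\Theta_1)]}$$ and, if the variance of $\Theta_1$ exists, $$|\mu_1-\mu_2|\leq d_{\mathcal{W}}(P_1,P_2)\leq \|\rho'\|_{\infty}\frac{{\rm Var}[\Theta_1]}{{\rm E}[\rho(\Theta_1)]},$$ where $\|\cdot\|_{\infty}$ is the infinity norm.
   Context: The Wasserstein-1 distance between distributions $P_1,P_2$ on $\mathbb{R}$ is $d_{\mathcal W}(P_1,P_2)=\sup_{h\in\mathcal{H}}|{\rm E}[h(X_1)]-{\rm E}[h(X_2)]|$ with $X_1\sim P_1$, $X_2\sim P_2$ and $\mathcal{H}$ the class of Lipschitz-1 functions (i.e. $|h(u)-h(v)|\le|u-v|$ for all $u,v\in\mathbb{R}$). The observations may be continuous or discrete; the posterior densities $p_i(\cdot;x)$ are with respect to Lebesgue measure in $\theta$. The support $I_i=(a_i,b_i)$, $-\infty\le a_i<b_i\le\infty$, is the open interval on which $p_i(\cdot;x)$ is positive, and $p_i(\cdot;x)=0$ outside $I_i$. By definition $p_2(\theta;x)=\frac{\kappa_2(x)}{\kappa_1(x)}\rho(\theta)p_1(\theta;x)$ on $I_1$; in particular $\rho=0$ on $I_1\setminus I_2$, and $\rho'$ is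 taken to be $0$ on $I_1\setminus I_2$. The derivative in (ii) is the derivative in $\theta$ on $I_2$ (where it exists, i.e. almost everywhere), and integrability is with respect to Lebesgue measure. *)

(* Defs.v *)
(* MathComp-Analysis. *)
From HB Require Import structures.
From mathcomp Require Import all_boot all_order all_algebra.
From mathcomp Require Import all_classical all_reals all_analysis.
Import Order.TTheory GRing.Theory Num.Theory.
Import numFieldNormedType.Exports.

Set Implicit Arguments.
Unset Strict Implicit.
Unset Printing Implicit Defensive.

Local Open Scope classical_set_scope.
Local Open Scope ring_scope.

(* The real interval (a, b) with extended endpoints. *)
Definition eitv (R : realType) (a b : \bar R) : set R :=
  [set t | (a < t%:E)%E /\ (t%:E < b)%E].

(* Approach to an endpoint of eitv a b from inside; the last, irrelevant, case
   makes the match total. *)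
Definition left_end (R : realType) (a : \bar R) : set_system R :=
  match a with
  | r%:E => r^'+
  | -oo%E => -oo
  | +oo%E => +oo
  end.

Definition right_end (R : realType) (b : \bar R) : set_system R :=
  match b with
  | r%:E => r^'-
  | +oo%E => +oo
  | -oo%E => -oo
  end.

(* {f t | t in Theta} are densities of one observation with respect to a common
   reference measure nu: Lebesgue measure for continuous data, counting measure
   for discrete data. *)
Definition sampling_densities (R : realType) (d : measure_display)
    (X : measurableType d) (nu : {measure set X -> \bar R}) (Theta : set R)
    (f : R -> X -> R) : Prop :=
  forall t, Theta t ->
    [/\ measurable_fun [set: X] (f t), (forall z, 0 <= f t z)
      & (\int[nu]_z (f t z)%:E = 1)%E].

Definition likelihood (R : realType) (X : Type) (f : R -> X -> R) (n : nat)
    (x : 'I_n -> X) (t : R) : R :=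
  \prod_(j < n) f t (x j).

Definition nonneg_on (R : realType) (Theta : set R) (p : R -> R) : Prop :=
  forall t, Theta t -> 0 <= p t.

(* kappa p(t) l(x; t) on Theta and 0 off Theta. If the integral is 0 or +oo,
   this is the zero function, which is excluded by prob_density below. *)
Definition norm_const (R : realType) (Theta : set R) (p ell : R -> R) : R :=
  (fine (\int[lebesgue_measure]_(t in Theta) (p t * ell t)%:E)%E)^-1.

Definition posterior (R : realType) (Theta : set R) (p ell : R -> R) : R -> R :=
  (fun t => norm_const Theta p ell * p t * ell t) \_ Theta.

Definition prob_density (R : realType) (p : R -> R) : Prop :=
  [/\ measurable_fun [set: measurableTypeR R] p, (forall t, 0 <= p t)
    & (\int[lebesgue_measure]_t (p t)%:E = 1)%E].

Definition has_density (R : realType) (P : probability (measurableTypeR R) R)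
    (p : R -> R) : Prop :=
  forall A : set (measurableTypeR R), measurable A ->
    (P A = \int[lebesgue_measure]_(t in A) (p t)%:E)%E.

Definition support_itv (R : realType) (p : R -> R) (a b : \bar R) : Prop :=
  [/\ (a < b)%E, (forall t, eitv a b t -> 0 < p t)
    & (forall t, ~ eitv a b t -> p t = 0)].

Definition finite_mean (R : realType)
    (P : probability (measurableTypeR R) R) : Prop :=
  P.-integrable setT (fun t : R => t%:E).

Definition mean (R : realType) (P : probability (measurableTypeR R) R) : R :=
  fine ('E_P[fun t : R => t])%E.

Definition Lip1 (R : realType) : set (R -> R) := [set h | 1.-lipschitz h].

(* Meaningful when P1 and P2 have finite means, so that all expectations are
   finite; the supremum itself is taken in [0, +oo]. *)
Definition wasserstein1 (R : realType)
    (P1 P2 : probability (measurableTypeR R) R) : \bar R :=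
  ereal_sup [set (`| 'E_P1[h] - 'E_P2[h] |)%E | h in @Lip1 R].

Definition stein_kernel (R : realType) (p : R -> R) (a : \bar R) (mu : R)
    (t : R) : R :=
  (p t)^-1 * (\int[lebesgue_measure]_(y in eitv a t%:E) ((mu - y) * p y))%R.

Definition centered_primitive (R : realType)
    (P : probability (measurableTypeR R) R) (p : R -> R) (a : \bar R)
    (h : R -> R) (t : R) : R :=
  (\int[lebesgue_measure]_(y in eitv a t%:E)
     ((h y - fine ('E_P[h])%E) * p y))%R.

(* The ratio of the priors, on the support (a, b) of the first posterior. The
   values off (a, b), where the ratio may be meaningless (zero or undefined
   priors), are irrelevant for expectations under that posterior. *)
Definition prior_ratio (R : realType) (p1 p2 : R -> R) (a b : \bar R) :
    R -> R :=
  (fun t => p2 t / p1 t) \_ (eitv a b).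

(* Essential supremum of |g|. For g a derivative on an open interval, extended
   by 0, this is the supremum of |g| (Denjoy-Clarkson property). *)
Definition inf_norm (R : realType) (g : R -> R) : \bar R :=
  ('N[@lebesgue_measure R]_+oo [EFin \o g])%E.

(* Main.v *)
Require Import Defs.
From HB Require Import structures.
From mathcomp Require Import all_boot all_order all_algebra.
From mathcomp Require Import all_classical all_reals all_analysis.
From mathcomp Require Import measurable_realfun ess_sup_inf ring lra.
Import Order.TTheory GRing.Theory Num.Theory.
Import numFieldNormedType.Exports.

Set Implicit Arguments.
Unset Strict Implicit.
Unset Printing Implicit Defensive.

Local Open Scope classical_set_scope.
Local Open Scope ring_scope.

(** Write p and q for the two posterior densities, m_h for the P1-expectation
    of a Lipschitz-1 function h, F_h(t) for the integral of (h - m_h) p up to t,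
    and c = E[rho(Theta_1)]. Bayes' formula makes the posteriors comparable:
    rho p = c q, so that rho is c times the ratio of the posterior densities.

    Stein identity. The function G = rho F_h vanishes at both ends of I2 and has,
    almost everywhere on I2, the derivative
    rho' F_h + rho (h - m_h) p = rho' F_h + c (h - m_h) q.
    This derivative integrates to 0, so
      int rho' F_h = c (E[h(Theta_1)] - E[h(Theta_2)])
    ([stein_identity]). Using the fundamental theorem of calculus here needs
    care: F_h is only absolutely continuous and rho is only differentiable, so
    rho' may fail to be continuous or bounded. The point is that G has, at
    every point t, an increment bounded by C_t times the mass of an integrable
    function. Hence the null set where the derivative of G is not known
    contributes nothing to the variation of G, whatever the constants C_t, and
    G minus the integral of its derivative, whose derivative is 0 almost
    everywhere, is constant ([constant_of_null_derivative],
    [product_cumul_FTC]).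

    Bounds. For h = id, -F_id = tau_1 p, where tau_1 is the Stein kernel, which
    gives the formula for the difference of the means; and id is itself
    Lipschitz-1, which gives the lower bound. For the upper bound,
    |F_h| <= -F_id for every Lipschitz-1 function h ([cumul_Lip1_le]), since
    F_h(t) is unchanged when h is replaced by h - h(t) and
    |h(y) - h(t)| <= |y - t|. Finally the integral of -F_id is the variance
    of Theta_1 by Tonelli's theorem ([integral_stein_kernel]), which bounds
    E[tau_1 |rho'|] by the variance times the essential supremum of |rho'|. *)

(** * Functions with derivative zero almost everywhere *)

(** A local bound on increments by those of a monotone function is global: the
    bound propagates to the supremum of the points up to which it holds, and
    beyond. Neither function has to be continuous, which matters because Phi
    will be the distribution function of a measure chosen to dominate g near
    each point separately. *)
Lemma gauge_increment (R : realType) (g Phi : R -> R) (a b : R) : a <= b ->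
  (forall s t, a <= s -> s <= t -> t <= b -> Phi s <= Phi t) ->
  (forall t, a <= t <= b -> exists2 d : R, 0 < d & forall s, a <= s <= b ->
     `|s - t| < d -> `|g s - g t| <= `|Phi s - Phi t|) ->
  `|g b - g a| <= Phi b - Phi a.
Proof.
move=> ab ndPhi gPhi.
pose A := [set t | a <= t <= b /\ `|g t - g a| <= Phi t - Phi a].
have Aa : A a by rewrite /A /= !lexx ab !subrr normr0.
have supA : has_sup A.
  by split; [exists a | exists b => t [/andP[]]].
have ac : a <= sup A by apply: ub_le_sup => //; exact: supA.2.
have cb : sup A <= b by apply: ge_sup; [exists a|move=> t [/andP[]]].
set c := sup A in ac cb.
have cab : a <= c <= b by rewrite ac cb.
have [d d0 gd] := gPhi c cab.
(* transport the bound from one point of A to a later one *)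
have step s t : A s -> s <= t -> t <= b ->
    `|g t - g s| <= `|Phi t - Phi s| -> A t.
  move=> [/andP[as_ sb] gs] st tb gts; split.
    by rewrite tb (le_trans as_ st).
  have P1 := ndPhi _ _ as_ st tb.
  rewrite [leRHS]ger0_norm ?subr_ge0// in gts.
  have := ler_normD (g t - g s) (g s - g a).
  have -> : g t - g s + (g s - g a) = g t - g a by ring.
  move=> N; lra.
have Ac : A c.
  have [s As cs] := sup_adherent d0 supA.
  have sc : s <= c by apply: ub_le_sup => //; exact: supA.2.
  apply: (step s) => //; rewrite -/c in cs.
  rewrite distrC [leRHS]distrC; apply: gd; first by case: As.
  by rewrite ltr_distlC; apply/andP; split; lra.
have [bc|cltb] := leP b c.
  have -> : b = c by apply/eqP; rewrite eq_le bc cb.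
  by case: Ac.
pose t := Num.min b (c + d / 2).
have ct : c < t by rewrite lt_min cltb/= ltrDl divr_gt0.
have tb : t <= b by rewrite ge_min lexx.
have td : t <= c + d / 2 by rewrite ge_min lexx orbT.
have : A t.
  apply: (step c) => //; first exact: ltW.
  apply: gd; first by rewrite tb (le_trans ac (ltW ct)).
  rewrite ltr_norml; apply/andP; split; lra.
have sA : has_ubound A := supA.2.
move=> /(ub_le_sup sA); rewrite -/c => tc.
by have := lt_le_trans ct tc; rewrite ltxx.
Qed.

(** Outer regularity of Lebesgue measure together with the absolute continuity
    of the integral of w. *)
Lemma null_set_open_cover (R : realType) (w : R -> R) (N : set R) (e : R) :
  lebesgue_measure.-integrable setT (EFin \o w) -> (forall t, 0 <= w t) ->
  measurable N -> lebesgue_measure N = 0%E -> 0 < e ->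
  exists U : set R, [/\ open U, N `<=` U
    & (\int[lebesgue_measure]_(t in U) (w t)%:E <= e%:E)%E].
Proof.
move=> iw w0 mN N0 e0.
have [d [d0 wd]] := integral_normr_continuous iw e0.
have [|U [oU NU Ud]] := lebesgue_regularity_outer mN _ d0.
  by rewrite (_ : _ N = 0%E) ?ltry.
exists U; split => //.
have mU : measurable U by exact: open_measurable.
have iwU : lebesgue_measure.-integrable U (EFin \o w).
  exact: integrableS iw.
have Ud' : (lebesgue_measure U < d%:E)%E.
  rewrite -(setDUK NU) measureU//.
  - by rewrite (_ : _ N = 0%E) ?add0e.
  - exact: measurableD.
  - by rewrite setDIK.
rewrite -[leLHS]fineK ?integrable_fin_num// lee_fin.
apply: le_trans (ltW (wd _ mU Ud')).
by under [leRHS]eq_Rintegral do rewrite ger0_norm//.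
Qed.

(** The minimum and the maximum make this symmetric in s and t, so that bounds
    on increments need no case distinction. *)
Definition mass (R : realType) (w : R -> R) (s t : R) : R :=
  \int[lebesgue_measure]_(y in `]Num.min s t, Num.max s t]) w y.

Lemma massC (R : realType) (w : R -> R) (s t : R) : mass w s t = mass w t s.
Proof. by rewrite /mass minC maxC. Qed.

Lemma mass_le (R : realType) (w : R -> R) (s t : R) : s <= t ->
  mass w s t = \int[lebesgue_measure]_(y in `]s, t]) w y.
Proof. by move=> st; rewrite /mass (min_idPl st) (max_idPr st). Qed.

Lemma ball_between (R : realType) (s t y r : R) :
  Num.min s t < y <= Num.max s t -> `|s - t| < r -> `|t - y| < r.
Proof.
case: (leP s t) => st /andP[y1 y2].
  by rewrite ler0_norm ?ger0_norm; lra.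
by rewrite ger0_norm ?ler0_norm; lra.
Qed.

Lemma derivable_cvg_derive1 (R : realType) (f : R -> R) (t : R) :
  derivable f t 1 ->
  h^-1 *: (f (h + t) - f t) @[h --> 0^'] --> derive1 f t.
Proof.
have shiftE : (fun h : R => h^-1 *: ((f \o shift t) (h *: 1) - f t)) =
    (fun h : R => h^-1 *: (f (h + t) - f t)).
  by apply/funext => h /=; rewrite [_ *: 1]mulr1.
by rewrite /derivable shiftE.
Qed.

(** At the points of the exceptional null set N only a bound C_t on the ratio of
    increments to mass is known, with C_t unbounded in t. So N is covered by
    open sets U_n whose mass is so small that the measure with density
    v = sum_n (n + 1) 1_(U_n) w is smaller than e / 2; near a point with
    C_t <= n + 1 this measure dominates the increments of g. Elsewhere a small
    multiple of the length dominates them. *)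
Lemma constant_of_null_derivative (R : realType) (w g : R -> R) (a b : R) :
  lebesgue_measure.-integrable setT (EFin \o w) -> (forall t, 0 <= w t) ->
  a <= b ->
  (forall t, a <= t <= b -> exists C : R, exists2 d : R, 0 < d &
     forall s, a <= s <= b -> `|s - t| < d -> `|g s - g t| <= C * mass w s t) ->
  {ae lebesgue_measure, forall t, a <= t <= b -> derivable g t 1 /\ derive1 g t = 0} ->
  g b = g a.
Proof.
move=> iw w0 ab gw [N [mN N0 gN]].
apply/eqP; rewrite -subr_eq0 -normr_le0; apply/ler_addgt0Pl => e e0.
rewrite addr0.
pose e1 := e / (b - a + 1) / 2.
have ba1 : 0 < b - a + 1 by rewrite ltr_wpDl// subr_ge0.
have e10 : 0 < e1 by rewrite !divr_gt0.
(* the extra factor n + 1 offsets the weight of U_n in v *)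
pose en (n : nat) := e / 2 / (2 ^ n.+1)%:R / n.+1%:R.
have en0 n : 0 < en n by rewrite !divr_gt0// ltr0n expn_gt0.
pose U n := projT1 (cid (null_set_open_cover iw w0 mN N0 (en0 n))).
have UP n : [/\ open (U n), N `<=` U n
    & (\int[lebesgue_measure]_(t in U n) (w t)%:E <= (en n)%:E)%E].
  by rewrite /U; case: cid.
have mU n : measurable (U n) by case: (UP n) => oU _ _; exact: open_measurable.
have mw : measurable_fun setT w by apply/measurable_EFinP; case/integrableP : (iw).
pose vn n t := ((n.+1%:R * w t) * \1_(U n) t)%:E.
have vn0 n t : (0 <= vn n t)%E by rewrite lee_fin !mulr_ge0.
have mvn n : measurable_fun setT (vn n).
  apply/measurable_EFinP; apply: measurable_funM => //.
  exact: measurable_funM.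
have intvn n : (\int[lebesgue_measure]_t vn n t <= (e / 2 / (2 ^ n.+1)%:R)%:E)%E.
  have vnE : vn n = ((fun t => n.+1%:R%:E * (w t)%:E)%E \_ (U n)).
    apply/funext => t; rewrite /vn patchE indicE.
    by case: (t \in U n); rewrite ?mulr1 ?mulr0 ?EFinM.
  rewrite vnE -integral_mkcond ge0_integralZl//; last 3 first.
  - exact: mU.
  - by apply/measurable_EFinP; exact: measurable_funTS.
  - by move=> t _; rewrite lee_fin.
  have [_ _ Un] := UP n.
  apply: (le_trans (lee_wpmul2l _ Un)); first by rewrite lee_fin.
  by rewrite -EFinM lee_fin /en mulrC divfK.
pose v t := (\sum_(n <oo) vn n t)%E.
have v0 t : (0 <= v t)%E by apply: nneseries_ge0 => k _ _; exact: vn0.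
have mv : measurable_fun setT v.
  by apply: ge0_emeasurable_sum.
have intv : (\int[lebesgue_measure]_t v t <= (e / 2)%:E)%E.
  rewrite integral_nneseries//.
  have e20 : 0 <= e / 2 by rewrite ltW// divr_gt0.
  apply: (le_trans _ (epsilon_trick0 xpredT e20)).
  apply: lee_nneseries => k *; first exact: integral_ge0.
  exact: intvn.
have vset A : measurable A -> ((\int[lebesgue_measure]_(t in A) v t)%E \is a fin_num).
  move=> mA; rewrite ge0_fin_numE ?integral_ge0//.
  apply: (@le_lt_trans _ _ (e / 2)%:E); last exact: ltry.
  by apply: le_trans intv; apply: ge0_subset_integral.
pose V s t : R := fine (\int[lebesgue_measure]_(y in `]s, t]) v y)%E.
have V0 s t : 0 <= V s t by rewrite fine_ge0// integral_ge0.
pose Phi t := e1 * (t - a) + V a t.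
have PhiD s t : a <= s -> s <= t -> Phi t - Phi s = e1 * (t - s) + V s t.
  move=> as_ st; rewrite /Phi.
  have -> : V a t = V a s + V s t.
    rewrite /V -fineD ?vset//.
    rewrite (@itv_bndbnd_setU _ _ (BRight a) (BRight s) (BRight t)) ?bnd_simp//.
    rewrite ge0_integral_setU//.
    - exact: measurable_funTS.
    - apply/disj_setPS => y [/=]; rewrite !in_itv/= => /andP[_ ys] /andP[].
      by rewrite ltNge ys.
  ring.
have PhiB s t : a <= s -> a <= t -> `|Phi s - Phi t| = e1 * `|s - t| +
    V (Num.min s t) (Num.max s t).
  wlog st : s t / s <= t.
    move=> H; case: (leP s t) => [st|/ltW ts] as_ at_.
      by rewrite (H s t)// (min_idPl st) (max_idPr st).
    by rewrite distrC (H t s)// (min_idPl ts) (max_idPr ts) (distrC s).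
  move=> as_ at_.
  rewrite distrC PhiD// (min_idPl st) (max_idPr st) ger0_norm.
    by rewrite distrC ger0_norm ?subr_ge0.
  by rewrite addr_ge0// mulr_ge0 ?subr_ge0// ltW.
(* one half of e for the length term, one half for the mass of v *)
have -> : e = e / 2 + e / 2 by lra.
have : `|g b - g a| <= Phi b - Phi a.
  apply: gauge_increment => //.
    move=> s t as_ st tb; rewrite -subr_ge0 PhiD//.
    by rewrite addr_ge0// mulr_ge0 ?subr_ge0// ltW.
  move=> t /[dup] tab /andP[at_ tb]; have [Nt|Nt] := pselect (N t).
    have [C [d d0 gC]] := gw t tab.
    pose n := Num.bound `|C|.
    have Cn : C <= n.+1%:R.
      apply: le_trans (ler_norm _) _; apply: le_trans (ltW (archi_boundP _)) _ => //.
      by rewrite ler_nat.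
    have [oU NU _] := UP n.
    have /nbhs_ballP[r /= r0 rU] : nbhs t (U n) by apply: open_nbhs_nbhs; split => //; exact: NU.
    exists (Num.min d r); first by rewrite lt_min d0.
    move=> s /[dup] sab /andP[as_ sb]; rewrite lt_min => /andP[sd sr].
    apply: (le_trans (gC s sab sd)).
    rewrite PhiB// ler_wpDl//; first by rewrite mulr_ge0// ltW.
    have m0 : 0 <= mass w s t by apply: Rintegral_ge0.
    apply: (le_trans (ler_wpM2r m0 Cn)).
    rewrite /mass /V; set J := [set` _].
    have mJ : measurable J by exact: measurable_itv.
    have iwJ : lebesgue_measure.-integrable J (EFin \o w) by exact: (integrableS _ _ _ iw).
    rewrite -lee_fin EFinM !fineK ?vset//; last exact: integrable_fin_num.
    rewrite -ge0_integralZl//; last 2 first.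
    - by case/integrableP : iwJ.
    - by move=> y _; rewrite lee_fin.
    apply: ge0_le_integral => //.
    - by move=> y _; rewrite mule_ge0// lee_fin.
    - by apply: emeasurable_funM => //; case/integrableP : iwJ.
    - exact: measurable_funTS.
    - move=> y Jy; have Uy : U n y.
        apply: rU; rewrite /ball/=.
        by apply: ball_between sr; move: Jy; rewrite /J/= in_itv.
      apply: (@le_trans _ _ (vn n y)).
        by rewrite /vn indicE mem_set// mulr1 EFinM.
      apply: (@le_trans _ _ (\sum_(0 <= i < n.+1) vn i y)%E).
        rewrite big_nat_recr//= leeDr//.
        by apply: sume_ge0 => i _.
      by apply: nneseries_lim_ge => i _ _.
  (* outside N the length term e1 |s - t| alone suffices *)
  have [dg g0] : derivable g t 1 /\ derive1 g t = 0.
    by apply: contrapT => H; apply: Nt; apply: gN => /= /(_ tab).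
  have := derivable_cvg_derive1 dg; rewrite g0.
  move=> /cvgrPdist_le /(_ e1 e10); rewrite near_withinE => /nbhs_ballP[r /= r0 rg].
  exists r => // s /andP[as_ sb] sr.
  rewrite PhiB// ler_wpDr//.
  have [->|st] := eqVneq s t; first by rewrite !subrr !normr0 mulr0.
  have := rg (s - t); rewrite /ball/= sub0r normrN => /(_ sr).
  rewrite subr_eq0 => /(_ st); rewrite subrK sub0r normrN normrZ normfV.
  by rewrite mulrC ler_pdivrMr ?normr_gt0 ?subr_eq0.
move=> /le_trans; apply.
rewrite PhiD// lerD//.
  rewrite /e1 mulrAC ler_wpM2r// mulrAC ler_pdivrMr// ler_wpM2l//; lra.
rewrite -lee_fin fineK ?vset//.
by apply: le_trans intv; exact: ge0_subset_integral.
Qed.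

(** * Indefinite integrals *)

Lemma lebesgue_measure_itvoc (R : realType) (s t : R) : s <= t ->
  lebesgue_measure `]s, t]%classic = (t - s)%:E.
Proof.
move=> st; rewrite lebesgue_measure_itv/= lte_fin; case: ifPn => // st'.
suff -> : s = t by rewrite subrr.
by apply/eqP; rewrite eq_le st leNgt.
Qed.

Definition cumul (R : realType) (f : R -> R) (t : R) : R :=
  \int[lebesgue_measure]_(y in `]-oo, t]) f y.

Section cumul.
Variables (R : realType) (f : R -> R).
Hypothesis intf : lebesgue_measure.-integrable setT (EFin \o f).

Lemma integrable_on (A : set R) : measurable A ->
  lebesgue_measure.-integrable A (EFin \o f).
Proof. by move=> mA; exact: (integrableS _ _ _ intf). Qed.

Lemma integrable_norm : lebesgue_measure.-integrable setT (EFin \o (fun t => `|f t|)).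
Proof. exact: integrable_abse intf. Qed.

Lemma cumulB (s t : R) : s <= t ->
  cumul f t - cumul f s = \int[lebesgue_measure]_(y in `]s, t]) f y.
Proof.
move=> st; rewrite /cumul; apply: Rintegral_itvB; rewrite ?bnd_simp//.
exact: integrable_on.
Qed.

Lemma cumul_mass (s t : R) :
  `|cumul f s - cumul f t| <= mass (fun y => `|f y|) s t.
Proof.
wlog st : s t / s <= t.
  move=> H; case: (leP s t) => [|/ltW] st; first exact: H.
  by rewrite distrC massC; exact: H.
rewrite distrC cumulB// mass_le//; apply: le_normr_Rintegral => //.
exact: integrable_on.
Qed.

Lemma cumul_bounded (t : R) : `|cumul f t| <= \int[lebesgue_measure]_y `|f y|.
Proof.
apply: (le_trans (le_normr_Rintegral _ _)) => //; first exact: integrable_on.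
have nf := integrable_norm.
rewrite -lee_fin /Rintegral !fineK ?integrable_fin_num//.
  apply: ge0_subset_integral => //; first by case/integrableP : nf.
by apply: integrableS nf.
Qed.

Lemma ae_derive_cumul : {ae lebesgue_measure, forall t,
  derivable (cumul f) t 1 /\ derive1 (cumul f) t = f t}.
Proof.
apply: FTC1Ny; first by move=> y; exact: integrable_on.
by apply: open_integrable_locally => //; exact: openT.
Qed.

Lemma measurable_cumul : measurable_fun setT (cumul f).
Proof.
have cont : continuous (cumul f).
  move=> t; apply/cvgrPdist_le => e e0.
  have [d [d0 fd]] := integral_normr_continuous intf e0.
  near=> s; apply: (le_trans (cumul_mass _ _)); rewrite /mass.
  apply/ltW/fd; first exact: measurable_itv.
  have st : Num.min t s <= Num.max t s by rewrite ge_min le_max lexx.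
  rewrite [ltLHS](lebesgue_measure_itvoc st) lte_fin.
  have -> : Num.max t s - Num.min t s = `|t - s|.
    by case: (leP t s) => ts; [rewrite ler0_norm|rewrite gtr0_norm]; lra.
  near: s; exact: cvgr_dist_lt.
by apply: continuous_measurable_fun.
Unshelve. all: by end_near. Qed.

End cumul.

Lemma le_mass (R : realType) (f g : R -> R) (s t : R) :
  lebesgue_measure.-integrable setT (EFin \o f) ->
  lebesgue_measure.-integrable setT (EFin \o g) ->
  (forall y, f y <= g y) -> mass f s t <= mass g s t.
Proof.
move=> intf intg fg; apply: le_Rintegral => //; exact: integrable_on.
Qed.

Lemma mass_indic (R : realType) (a b s t : R) : a <= s <= b -> a <= t <= b ->
  mass (\1_(`]a, b]%classic)) s t = `|s - t|.
Proof.
wlog st : s t / s <= t.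
  move=> H sab tab; case: (leP s t) => [|/ltW] st; first exact: H.
  by rewrite distrC massC; exact: H.
move=> /andP[as_ sb] /andP[at_ tb]; rewrite mass_le//.
rewrite /Rintegral integral_indic// setIC.
rewrite (_ : _ `&` _ = `]s, t]%classic); last first.
  apply/seteqP; split => y /=; rewrite !in_itv/=; first by case.
  by move=> /andP[y1 y2]; split; apply/andP; split; lra.
by rewrite [X in fine X](lebesgue_measure_itvoc st) ler0_norm ?subr_le0// opprB.
Qed.

Lemma derivable_lipschitz_at (R : realType) (rho : R -> R) (t : R) :
  derivable rho t 1 -> exists2 C : R, 0 <= C & exists2 d : R, 0 < d &
    forall s, `|s - t| < d -> `|rho s - rho t| <= C * `|s - t|.
Proof.
move=> /cvg_ex[l /= /cvgrPdist_le /(_ 1 ltr01)].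
rewrite near_withinE => /nbhs_ballP[r /= r0 H].
exists (`|l| + 1); first by rewrite addr_ge0.
exists r => // s sr; have [->|st] := eqVneq s t.
  by rewrite !subrr !normr0 mulr0.
have st0 : s - t != 0 by rewrite subr_eq0.
have {}H : `|l - (s - t)^-1 *: (rho s - rho t)| <= 1.
  have := H (s - t); rewrite /ball/= sub0r normrN => /(_ sr st0).
  by rewrite [_ *: 1]mulr1 subrK.
rewrite -ler_pdivrMr ?normr_gt0//.
have -> : `|rho s - rho t| / `|s - t| = `|(s - t)^-1 *: (rho s - rho t)|.
  by rewrite normrZ normfV mulrC.
move: ((s - t)^-1 *: _) H => q lq.
have := ler_normD l (q - l); rewrite addrC subrK => qD.
by rewrite (le_trans qD)// lerD2l distrC.
Qed.

(** The product of a differentiable function and an absolutely continuous one,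
    when its derivative agrees with an integrable D. The derivative of rho need
    not be integrable, so this is not integration by parts for absolutely
    continuous functions: at each point the increments of rho F - int D are
    bounded by a multiple of the mass of 1 + |phi| + |D|, with a factor that
    involves the derivative of rho at that point. *)
Lemma product_cumul_FTC (R : realType) (rho phi D : R -> R) (a b : R) :
  let G t := rho t * cumul phi t in
  lebesgue_measure.-integrable setT (EFin \o phi) ->
  lebesgue_measure.-integrable setT (EFin \o D) ->
  a <= b ->
  (forall t, a <= t <= b -> derivable rho t 1) ->
  (forall t, a <= t <= b -> derive1 G t = D t) ->
  G b - G a = cumul D b - cumul D a.
Proof.
move=> G intphi intD ab drho DG.
(* the indicator replaces the density 1, not integrable on the whole line *)
pose w y := (\1_(`]a, b]%classic) y + `|phi y|) + `|D y|.
have int1 := integrable_indic_itv a b false false.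
have intw1 : lebesgue_measure.-integrable setT
    (EFin \o (fun y => \1_(`]a, b]%classic) y + `|phi y|)).
  exact: (integrableD measurableT int1 (integrable_norm intphi)).
have intw : lebesgue_measure.-integrable setT (EFin \o w).
  exact: (integrableD measurableT intw1 (integrable_norm intD)).
pose g t := G t - cumul D t.
suff : g b = g a by rewrite /g; lra.
apply: (constant_of_null_derivative intw) => //.
- by move=> t; rewrite !addr_ge0.
- move=> t tab; have [C C0 [d d0 rhoC]] := derivable_lipschitz_at (drho t tab).
  pose M := \int[lebesgue_measure]_y `|phi y|.
  exists (C * M + `|rho t| + 1), d => // s sab std.
  have gE : g s - g t = (rho s - rho t) * cumul phi s +
      (rho t * (cumul phi s - cumul phi t) - (cumul D s - cumul D t)).
    by rewrite /g /G; ring.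
  have M0 : 0 <= M by exact: Rintegral_ge0.
  have m1 : `|s - t| <= mass w s t.
    rewrite -(mass_indic sab tab); apply: le_mass => // y.
    by rewrite /w -addrA lerDl addr_ge0.
  have m2 : `|cumul phi s - cumul phi t| <= mass w s t.
    apply: le_trans (cumul_mass intphi _ _) _.
    apply: le_mass => //; first exact: integrable_norm.
    by move=> y; rewrite /w addrAC lerDr addr_ge0.
  have m3 : `|cumul D s - cumul D t| <= mass w s t.
    apply: le_trans (cumul_mass intD _ _) _.
    apply: le_mass => //; first exact: integrable_norm.
    by move=> y; rewrite /w lerDr addr_ge0.
  rewrite gE [leRHS]mulrDl [in leRHS]mulrDl mul1r -addrA; apply: (le_trans (ler_normD _ _)).
  apply: lerD.
    rewrite normrM mulrAC; apply: ler_pM => //; last exact: cumul_bounded.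
    by apply: (le_trans (rhoC _ std)); rewrite ler_wpM2l.
  apply: (le_trans (ler_normB _ _)); apply: lerD => //.
  by rewrite normrM ler_wpM2l.
- have := ae_derive_cumul intphi; have := ae_derive_cumul intD.
  apply: filterS2; first exact: (ae_filter_ringOfSetsType lebesgue_measure).
  move=> t [dD Dt] [dphi _] tab.
  have dG : derivable G t 1 := derivableM (drho t tab) dphi.
  split; first exact: derivableB.
  have gE : 'D_1 g t = 'D_1 G t - 'D_1 (cumul D) t := deriveB dG dD.
  by rewrite derive1E gE -!derive1E Dt DG// subrr.
Qed.

(** * Open intervals and their ends *)

Lemma open_eitv (R : realType) (a b : \bar R) : open (eitv a b).
Proof.
rewrite openE => t [at_ tb]; rewrite /interior.
have A : \forall s \near t, (a < s%:E)%E.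
  case: a at_ => [r| |]; [|by []|by move=> _; apply: (@nearW _ (nbhs t)) => s; rewrite ltNyr].
  by rewrite lte_fin => rt; near=> s; rewrite lte_fin; near: s; exact: lt_nbhsr.
have B : \forall s \near t, (s%:E < b)%E.
  case: b tb => [r| |]; [|by move=> _; apply: (@nearW _ (nbhs t)) => s; rewrite ltry|by []].
  by rewrite lte_fin => rt; near=> s; rewrite lte_fin; near: s; exact: lt_nbhsl.
by apply: filterS2 A B => s; split.
Unshelve. all: by end_near. Qed.

Lemma measurable_eitv (R : realType) (a b : \bar R) : measurable (eitv a b).
Proof. by apply: open_measurable; exact: open_eitv. Qed.

Lemma harmonic_le1 (R : realType) (n : nat) : @harmonic R n <= 1.
Proof. by rewrite /harmonic invf_le1 ?ltr0n// ler1n. Qed.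

Lemma left_end_sequence (R : realType) (a : \bar R) (c : R) : (a < c%:E)%E ->
  exists u : nat -> R, [/\ u @ \oo --> left_end a,
    forall n, (a < (u n)%:E)%E & forall n, u n <= c].
Proof.
case: a => [r| |] /=; rewrite ?lte_fin// => rc.
  pose u n := r + (c - r) * @harmonic R n.
  have ur n : r < u n by rewrite ltrDl mulr_gt0 ?subr_gt0// harmonic_gt0.
  have uc n : u n <= c.
    by rewrite /u -lerBrDl ler_piMr ?harmonic_le1// subr_ge0 ltW.
  exists u; split => // A rA.
  have ucvg : u @ \oo --> r.
    rewrite -[X in _ --> X]addr0 -[X in _ --> r + X](mulr0 (c - r)).
    by apply: cvgD; [exact: cvg_cst|apply: cvgMr; exact: cvg_harmonic].
  have rAu : \forall n \near \oo, r < u n -> A (u n) := ucvg _ rA.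
  suff : \forall n \near \oo, A (u n) by [].
  by apply: filterS rAu => n; apply.
exists (fun n => c - n%:R); split => [|n|n]; rewrite ?ltNyr ?gerBl//.
apply/cvgrNyPle => A; near=> n; rewrite lerBlDr -lerBlDl.
by near: n; exact: nbhs_infty_ger.
Unshelve. all: by end_near. Qed.

Lemma right_end_sequence (R : realType) (b : \bar R) (c : R) : (c%:E < b)%E ->
  exists v : nat -> R, [/\ v @ \oo --> right_end b,
    forall n, ((v n)%:E < b)%E & forall n, c <= v n].
Proof.
case: b => [r| |] /=; rewrite ?lte_fin// => cr.
  pose v n := r - (r - c) * @harmonic R n.
  have vr n : v n < r by rewrite ltrBlDr ltrDl mulr_gt0 ?subr_gt0// harmonic_gt0.
  have vc n : c <= v n.
    by rewrite /v lerBrDr -lerBrDl ler_piMr ?harmonic_le1// subr_ge0 ltW.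
  exists v; split => // A rA.
  have vcvg : v @ \oo --> r.
    rewrite -[X in _ --> X]subr0 -[X in _ --> r - X](mulr0 (r - c)).
    by apply: cvgB; [exact: cvg_cst|apply: cvgMr; exact: cvg_harmonic].
  have rAv : \forall n \near \oo, v n < r -> A (v n) := vcvg _ rA.
  suff : \forall n \near \oo, A (v n) by [].
  by apply: filterS rAv => n; apply.
exists (fun n => c + n%:R); split => [|n|n]; rewrite ?ltry ?lerDl//.
apply/cvgryPge => A; near=> n; rewrite -lerBlDl.
by near: n; exact: nbhs_infty_ger.
Unshelve. all: by end_near. Qed.

Lemma left_end_lt (R : realType) (a : \bar R) (t : R) : (a < t%:E)%E ->
  left_end a [set s | s < t].
Proof.
case: a => [r| |] //=; rewrite ?lte_fin => rt; first exact: nbhs_right_lt.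
by apply: nbhs_ninfty_lt; exact: num_real.
Qed.

Lemma right_end_gt (R : realType) (b : \bar R) (t : R) : (t%:E < b)%E ->
  right_end b [set s | t < s].
Proof.
case: b => [r| |] //=; rewrite ?lte_fin => rt; first exact: nbhs_left_gt.
by apply: nbhs_pinfty_gt; exact: num_real.
Qed.

Lemma eitv_nonempty (R : realType) (a b : \bar R) : (a < b)%E ->
  exists c, eitv a b c.
Proof.
case: a b => [r| |] [s| |] //=; rewrite ?lte_fin => rs.
- by exists ((r + s) / 2); rewrite /eitv/= !lte_fin midf_lt//= midf_lt.
- by exists (r + 1); rewrite /eitv/= lte_fin ltrDl ltry.
- by exists (s - 1); rewrite /eitv/= lte_fin ltNyr gtrBl.
- by exists 0; rewrite /eitv/= ltNyr ltry.
Qed.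

(** Sequences tending to the two ends reduce the limit along the endpoint
    filters to dominated convergence of the integrals over ]u_n, v_n]. *)
Lemma integral_of_vanishing_primitive (R : realType) (G D : R -> R) (a b : \bar R) :
  (a < b)%E ->
  lebesgue_measure.-integrable setT (EFin \o D) ->
  (forall t, ~ eitv a b t -> D t = 0) ->
  (forall s t, (a < s%:E)%E -> s <= t -> (t%:E < b)%E ->
     G t - G s = cumul D t - cumul D s) ->
  G t @[t --> left_end a] --> 0 -> G t @[t --> right_end b] --> 0 ->
  \int[lebesgue_measure]_t D t = 0.
Proof.
move=> ab intD D0 GD Ga Gb.
have [c [ac cb]] := eitv_nonempty ab.
have [u [ua au uc]] := left_end_sequence ac.
have [v [vb bv cv]] := right_end_sequence cb.
have Gu : G (u n) @[n --> \oo] --> 0 by exact: cvg_comp ua Ga.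
have Gv : G (v n) @[n --> \oo] --> 0 by exact: cvg_comp vb Gb.
have GE n : G (v n) - G (u n) = \int[lebesgue_measure]_(y in `]u n, v n]) D y.
  have uv : u n <= v n := le_trans (uc n) (cv n).
  by rewrite GD// cumulB.
pose f_ n t := ((D \_ `]u n, v n]) t)%:E.
have mD : measurable_fun setT D by apply/measurable_EFinP; case/integrableP : intD.
have cvgD : (\int[lebesgue_measure]_t f_ n t)%E @[n --> \oo] -->
    (\int[lebesgue_measure]_t (D t)%:E)%E.
  apply: (@dominated_cvg _ _ _ lebesgue_measure setT _ _ _ (fun t => `|(D t)%:E|%E)) => //.
  - move=> n; apply/measurable_EFinP.
    by apply/(measurable_restrictT _ _).1 => //; exact: measurable_funTS.
  - move=> t _; apply: cvg_near_cst.
    have [Dt|Dt] := pselect (eitv a b t); last first.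
      by apply: nearW => n; rewrite /f_ patchE; case: ifP => // _; rewrite D0.
    have ut := ua _ (left_end_lt Dt.1); have vt := vb _ (right_end_gt Dt.2).
    near=> n; rewrite /f_ patchE mem_set//= in_itv/=.
    have -> /= : u n < t by near: n.
    by apply/ltW; near: n.
  - exact: integrable_abse.
  - move=> n t _; rewrite /f_ patchE; case: ifP => // _.
    by rewrite abse0 abse_ge0.
have GvGu : G (v n) - G (u n) @[n --> \oo] --> 0.
  by rewrite -[X in _ --> X](subr0 0); exact: cvgB.
have cvgG : (\int[lebesgue_measure]_t f_ n t)%E @[n --> \oo] --> 0%E.
  have -> : (fun n => \int[lebesgue_measure]_t f_ n t)%E =
      EFin \o (fun n => G (v n) - G (u n)).
    apply/funext => n /=; rewrite GE fineK.
      by rewrite [RHS]integral_mkcond; apply: eq_integral => t _; rewrite restrict_EFin.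
    apply: integrable_fin_num => //; exact: integrable_on.
  by apply: cvg_EFin => //; exact: nearW.
by rewrite /Rintegral (cvg_unique _ cvgD cvgG).
Unshelve. all: by end_near. Qed.

Lemma Rintegral_eitv_cumul (R : realType) (f : R -> R) (a b : \bar R) (t : R) :
  lebesgue_measure.-integrable setT (EFin \o f) ->
  (forall y, ~ eitv a b y -> f y = 0) ->
  \int[lebesgue_measure]_(y in eitv a t%:E) f y = cumul f t.
Proof.
move=> intf f0; rewrite /cumul -Rintegral_itv_bndo_bndc; last exact: integrable_on.
rewrite Rintegral_mkcond [RHS]Rintegral_mkcond; apply: eq_Rintegral => y _.
rewrite !patchE mem_setE in_itv/=.
have [yt|ty] := ltP y t; last first.
  case: ifPn => //; rewrite inE => -[_]; rewrite lte_fin => yt.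
  by have := lt_le_trans yt ty; rewrite ltxx.
case: ifPn => //; rewrite notin_setE => nay.
by rewrite f0// => -[ay _]; apply: nay.
Qed.

(** * Expectations through densities *)

(** On A the derivative is the pointwise limit of the difference quotients with
    step 1 / (n + 1), each of which is measurable on the whole line. *)
Lemma measurable_derive1 (R : realType) (f : R -> R) (A : set R) :
  measurable A -> measurable_fun setT f -> (forall t, A t -> derivable f t 1) ->
  measurable_fun setT (derive1 f \_ A).
Proof.
move=> mA mf df; apply/(measurable_restrictT _ _).1 => //.
pose e n : R := @harmonic R n.
have e0 n : e n != 0 by rewrite gt_eqF// harmonic_gt0.
apply: (measurable_fun_cvg (h := fun n t => (e n)^-1 * (f (e n + t) - f t))).
  move=> n; apply: measurable_funTS; apply: measurable_funM => //.
  apply: measurable_funB => //; apply: measurableT_comp => //.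
  exact: measurable_funD.
move=> t At.
have ecvg : e @ \oo --> 0^'.
  move=> B B0.
  have He : \forall n \near \oo, e n != 0 -> B (e n) := @cvg_harmonic R _ B0.
  suff : \forall n \near \oo, B (e n) by [].
  by apply: filterS He => n; apply.
exact: (cvg_comp _ _ ecvg (derivable_cvg_derive1 (df t At))).
Qed.

(** On nonnegative reals the inverse, 0 included, is the power of exponent -1. *)
Lemma measurable_inv_ge0 (R : realType) (p : R -> R) : (forall t, 0 <= p t) ->
  measurable_fun setT p -> measurable_fun setT (fun t => (p t)^-1).
Proof.
move=> p0 mp; rewrite (_ : (fun t => _) = (fun t => p t `^ (-1))); last first.
  by apply/funext => t; rewrite powR_inv1.
exact: (measurableT_comp (measurable_powR (-1)) mp).
Qed.

Section density.
Variables (R : realType) (P : probability (measurableTypeR R) R) (p : R -> R).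
Hypotheses (dp : prob_density p) (Pp : has_density P p).

Lemma prob_density_integrable : lebesgue_measure.-integrable setT (EFin \o p).
Proof.
have [mp p0 p1] := dp; apply/integrableP; split; first exact/measurable_EFinP.
under eq_integral do rewrite /= ger0_norm//.
by rewrite p1 ltry.
Qed.

Lemma density_dominates : P `<< (lebesgue_measure : {measure set (measurableTypeR R) -> \bar R}).
Proof.
have [mp p0 p1] := dp.
apply/null_content_dominatesP => A mA A0; rewrite Pp//.
by apply: null_set_integral => //; apply/measurable_EFinP; exact: measurable_funTS.
Qed.

(** p is almost everywhere the Radon-Nikodym derivative of P with respect to
    Lebesgue measure, for which the change of variables is known. *)
Lemma ge0_expectation_density (g : R -> \bar R) : (forall t, 0 <= g t)%E ->
  measurable_fun setT g ->
  (\int[P]_t g t = \int[lebesgue_measure]_t (g t * (p t)%:E))%E.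
Proof.
have [mp p0 p1] := dp => g0 mg.
rewrite -(Radon_Nikodym_SigmaFinite.change_of_variables density_dominates g0 measurableT mg).
have intd := Radon_Nikodym_SigmaFinite.f_integrable density_dominates.
apply: ae_eq_integral => //.
- by apply: emeasurable_funM => //; exact: measurable_int intd.
- by apply: emeasurable_funM => //; exact/measurable_EFinP.
- apply: ae_eqe_mul2l; apply: integral_ae_eq => //.
    exact/measurable_EFinP.
  move=> E _ mE; exact: etrans (esym (Radon_Nikodym_SigmaFinite.f_integral density_dominates mE)) (Pp mE).
Qed.

(** Both sides are differences of the integrals of the positive and negative
    parts, which multiplying by p >= 0 preserves; so the identity also covers
    infinite expectations. *)
Lemma expectation_density (g : R -> R) : measurable_fun setT g ->
  ('E_P[g] = \int[lebesgue_measure]_t (g t * p t)%:E)%E.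
Proof.
have [mp p0 p1] := dp => mg; rewrite unlock.
have mEg : measurable_fun setT (fun t : R => (g t)%:E) by exact/measurable_EFinP.
rewrite [LHS]integralE [RHS]integralE; congr (_ - _)%E.
  rewrite ge0_expectation_density//; last exact: measurable_funepos.
  apply: eq_integral => t _; rewrite !funeposE EFinM.
  by rewrite maxe_pMl ?lee_fin// mul0e.
rewrite ge0_expectation_density//; last exact: measurable_funeneg.
apply: eq_integral => t _; rewrite !funenegE EFinM -mulNe.
by rewrite maxe_pMl ?lee_fin// mul0e.
Qed.

Lemma integrable_density (g : R -> R) : measurable_fun setT g ->
  P.-integrable setT (EFin \o g) <->
  lebesgue_measure.-integrable setT (EFin \o (fun t => g t * p t)).
Proof.
have [mp p0 p1] := dp => mg.
have E : (\int[P]_t `|(EFin \o g) t| =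
    \int[lebesgue_measure]_t `|(EFin \o (fun t => g t * p t)%R) t|)%E.
  rewrite ge0_expectation_density//; last first.
    by apply: measurableT_comp => //; exact/measurable_EFinP.
  apply: eq_integral => t _ /=; rewrite normrM (ger0_norm (p0 t))// EFinM//.
split=> /integrableP[_ gfin]; apply/integrableP; split.
- by apply/measurable_EFinP; exact: measurable_funM.
- by rewrite -E.
- exact/measurable_EFinP.
- by rewrite E.
Qed.

End density.

(** * Lipschitz-1 functions and the Stein kernel *)

Lemma Lip1P (R : realType) (h : R -> R) : Lip1 h ->
  forall y z, `|h y - h z| <= `|y - z|.
Proof.
move=> lh y z; have := lh (y, z); rewrite /= mul1r; apply.
by split.
Qed.

Lemma measurable_Lip1 (R : realType) (h : R -> R) : Lip1 h ->
  measurable_fun setT h.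
Proof.
move=> /Lip1P lh; apply: continuous_measurable_fun => t.
apply/cvgrPdist_le => e e0; near=> s.
by apply: (le_trans (lh _ _)); near: s; exact: cvgr_dist_le.
Unshelve. all: by end_near. Qed.

Lemma Lip1_id (R : realType) : Lip1 (fun t : R => t).
Proof. by move=> [y z] _ /=; rewrite mul1r. Qed.

Lemma Lip1_opp (R : realType) : Lip1 (fun t : R => - t).
Proof. by move=> [y z] _ /=; rewrite mul1r -opprD normrN. Qed.

Section stein_kernel_bound.
Variables (R : realType) (p : R -> R).
Hypotheses (dp : prob_density p).
Hypothesis ip : lebesgue_measure.-integrable setT (EFin \o (fun y => y * p y)).

Let p0 t : 0 <= p t. Proof. by case: dp => _ + _; exact. Qed.
Let mp : measurable_fun setT p. Proof. by case: dp. Qed.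
Let intp := prob_density_integrable dp.

Let intp1 : \int[lebesgue_measure]_y p y = 1.
Proof. by rewrite /Rintegral; case: dp => _ _ ->. Qed.

Lemma integrable_Lip1 (h : R -> R) : Lip1 h ->
  lebesgue_measure.-integrable setT (EFin \o (fun y => h y * p y)).
Proof.
move=> lh; have mh := measurable_Lip1 lh.
have int0 : lebesgue_measure.-integrable setT (EFin \o (fun y => `|h 0| * p y)).
  exact: (integrableZl measurableT `|h 0| intp).
have int01 := integrableD measurableT int0 (integrable_norm ip).
apply: le_integrable int01 => //.
  by apply/measurable_EFinP; exact: measurable_funM.
move=> y _ /=; rewrite lee_fin [leRHS]ger0_norm ?addr_ge0 ?mulr_ge0//.
rewrite !normrM (ger0_norm (p0 y)) -mulrDl ler_wpM2r//.
have := Lip1P lh y 0; rewrite subr0 => hy.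
have := ler_normD (h y - h 0) (h 0); rewrite subrK => hD.
by rewrite (le_trans hD)// addrC lerD2l.
Qed.

Lemma integrable_Lip1B (h : R -> R) (k : R) : Lip1 h ->
  lebesgue_measure.-integrable setT (EFin \o (fun y => (h y - k) * p y)).
Proof.
move=> lh; apply: integrable_Lip1 => -[y z] _ /=.
have -> : h y - k - (h z - k) = h y - h z by ring.
by rewrite mul1r; exact: Lip1P.
Qed.

Lemma integrable_subl (k : R) :
  lebesgue_measure.-integrable setT (EFin \o (fun y => (k - y) * p y)).
Proof.
have := integrable_Lip1B (- k) (@Lip1_opp R); congr (integrable _ _ _).
by apply/funext => y /=; rewrite opprK addrC.
Qed.

Let tail (f : R -> R) (t : R) := \int[lebesgue_measure]_(y in `]t, +oo[) f y.

Let cumul_tail (f : R -> R) (t : R) :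
  lebesgue_measure.-integrable setT (EFin \o f) ->
  \int[lebesgue_measure]_y f y = cumul f t + tail f t.
Proof.
move=> intf; rewrite /cumul /tail -Rintegral_setU//.
- by rewrite -itv_bndbnd_setU// set_itvNyy.
- by rewrite -itv_bndbnd_setU// set_itvNyy.
- by apply/disj_setPS => y [/=]; rewrite !in_itv/= andbT => yt /(le_lt_trans yt); rewrite ltxx.
Qed.

Let linear_part (A : set R) (h : R -> R) (k : R) : measurable A -> Lip1 h ->
  \int[lebesgue_measure]_(y in A) ((h y - k) * p y) =
  \int[lebesgue_measure]_(y in A) (h y * p y) - k * \int[lebesgue_measure]_(y in A) p y.
Proof.
move=> mA lh; have inth := integrable_Lip1 lh.
under eq_Rintegral do rewrite mulrBl.
rewrite RintegralB//.
- rewrite RintegralZl//; exact: integrable_on.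
- exact: integrable_on.
- by apply: integrable_on => //; exact: (integrableZl measurableT k intp).
Qed.

(** The centered integral of h is unchanged by h -> h - k. Splitting the mean at
    t, with A = cumul p t and 1 - A = tail p t, gives
    m_L - (m_L + m_R) A = (1 - A) m_L - A m_R, where m_L and m_R are the parts
    of the mean below and above t. *)
Lemma cumul_centered (h : R -> R) (k t : R) : Lip1 h ->
  let m := \int[lebesgue_measure]_y (h y * p y) in
  cumul (fun y => (h y - m) * p y) t =
  tail p t * cumul (fun y => (h y - k) * p y) t -
  cumul p t * tail (fun y => (h y - k) * p y) t.
Proof.
move=> lh m; have inth := integrable_Lip1 lh.
rewrite /cumul /tail !linear_part// -!/(cumul _ _) -!/(tail _ _).
have := cumul_tail t intp; rewrite intp1 => pt.
rewrite /m (cumul_tail t inth).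
have -> : tail p t = 1 - cumul p t by rewrite pt addrC addKr.
ring.
Qed.

(** With the pivot k = h t, both terms of [cumul_centered] are bounded by those
    for the function -id with the pivot -t, both of which are nonnegative. *)
Lemma cumul_Lip1_le (h : R -> R) (t : R) : Lip1 h ->
  let m := \int[lebesgue_measure]_y (h y * p y) in
  let mu := \int[lebesgue_measure]_y (y * p y) in
  is_true (`|cumul (fun y => (h y - m) * p y) t| <= cumul (fun y => (mu - y) * p y) t).
Proof.
move=> lh m mu.
have -> : cumul (fun y => (mu - y) * p y) t =
    tail p t * cumul (fun y => (t - y) * p y) t -
    cumul p t * tail (fun y => (t - y) * p y) t.
  have := cumul_centered (- t) t (@Lip1_opp R) => /=.
  have -> : \int[lebesgue_measure]_y (- y * p y) = - mu.
    under eq_Rintegral do rewrite mulNr -mulN1r.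
    by rewrite RintegralZl// mulN1r.
  have E (c : R) : (fun y => (- y - - c) * p y) = (fun y => (c - y) * p y).
    by apply/funext => y; rewrite opprK addrC.
  by rewrite !E.
rewrite (cumul_centered (h t) t lh); apply: (le_trans (ler_normB _ _)).
have T0 : 0 <= tail p t by exact: Rintegral_ge0.
have C0 : 0 <= cumul p t by exact: Rintegral_ge0.
have intl := integrable_subl t.
have inth := integrable_Lip1B (h t) lh.
rewrite !normrM (ger0_norm T0) (ger0_norm C0); apply: lerD.
  apply: ler_wpM2l => //; apply: (le_trans (le_normr_Rintegral _ _)) => //.
    exact: integrable_on.
  apply: le_Rintegral => //.
  - exact: (integrable_on (integrable_norm inth)).
  - exact: integrable_on.
  - move=> y; rewrite /= in_itv/= => yt.
    rewrite normrM (ger0_norm (p0 y)) ler_wpM2r//.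
    by apply: (le_trans (Lip1P lh _ _)); rewrite ler0_norm ?subr_le0// opprB.
(* above t, t - y is negative and its negative bounds |h y - h t| *)
rewrite -mulrN; apply: ler_wpM2l => //.
rewrite -[- tail _ _]mulN1r -RintegralZl//; last exact: integrable_on.
apply: (le_trans (le_normr_Rintegral _ _)) => //.
  exact: integrable_on.
apply: le_Rintegral => //.
- exact: (integrable_on (integrable_norm inth)).
- by apply: (integrable_on (integrableZl measurableT (-1) intl)).
- move=> y; rewrite /= in_itv/= andbT => ty.
  rewrite normrM (ger0_norm (p0 y)) mulrA ler_wpM2r// mulN1r opprB.
  by apply: (le_trans (Lip1P lh _ _)); rewrite ger0_norm ?subr_ge0// ltW.
Qed.

(** Since (mu - y) p changes sign, Tonelli's theorem does not apply to it
    directly. As its total integral is 0, its integral up to t is, for t > mu,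
    also that of (y - mu) p beyond t; so for every t it is the integral of a
    nonnegative kernel k(t, y). For fixed y the values t that count form an
    interval between y and mu, of length |y - mu|, whence (y - mu)^2. *)
Lemma integral_stein_kernel :
  let mu := \int[lebesgue_measure]_y (y * p y) in
  (\int[lebesgue_measure]_t (cumul (fun y => (mu - y) * p y) t)%:E =
   \int[lebesgue_measure]_y ((y - mu) ^+ 2 * p y)%:E)%E.
Proof.
move=> mu.
pose b (z : R * R) := (z.2 <= z.1) && (z.1 <= mu) || (mu < z.1) && (z.1 < z.2).
pose k (z : R * R) : \bar R := if b z then (`|z.2 - mu| * p z.2)%:E else 0%E.
have k0 z : (0 <= k z)%E by rewrite /k; case: ifP; rewrite // lee_fin mulr_ge0.
have mk : measurable_fun setT k.
  apply: measurable_fun_ifT => //.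
    apply: measurable_or; apply: measurable_and.
    - exact: measurable_fun_ler.
    - exact: measurable_fun_ler.
    - exact: measurable_fun_ltr.
    - exact: measurable_fun_ltr.
  apply/measurable_EFinP; apply: measurable_funM.
    apply: measurableT_comp => //; exact: measurable_funB.
  exact: measurableT_comp.
have intc := integrable_subl mu.
have intc0 : \int[lebesgue_measure]_y ((mu - y) * p y) = 0.
  under eq_Rintegral do rewrite mulrBl.
  rewrite RintegralB//; last exact: (integrableZl measurableT mu intp).
  by rewrite RintegralZl// intp1 mulr1 subrr.
transitivity (\int[lebesgue_measure]_t \int[lebesgue_measure]_y k (t, y))%E.
  apply: eq_integral => t _; rewrite /k /b/=.
  have [tmu|mut] := leP t mu.
    rewrite /cumul /Rintegral fineK; last first.
      by apply: integrable_fin_num => //; exact: integrable_on.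
    rewrite integral_mkcond; apply: eq_integral => y _.
    rewrite patchE mem_setE in_itv/= andbT orbF; case: ifP => // yt.
    by rewrite ler0_norm ?opprB// subr_le0 (le_trans yt).
  have -> : cumul (fun y => (mu - y) * p y) t = tail (fun y => (y - mu) * p y) t.
    have := cumul_tail t intc; rewrite intc0 => /esym/eqP; rewrite addr_eq0 => /eqP ->.
    rewrite -mulN1r -RintegralZl//; last exact: integrable_on.
    by apply: eq_Rintegral => y _; rewrite mulN1r -mulNr opprB.
  rewrite /tail /Rintegral fineK; last first.
    apply: integrable_fin_num => //; apply: integrable_on => //.
    have := integrableZl measurableT (-1) intc; congr (integrable _ _ _).
    by apply/funext => y /=; rewrite -EFinM; congr EFin; ring.
  rewrite integral_mkcond; apply: eq_integral => y _.
  rewrite patchE mem_setE in_itv/= andbT andbF/=; case: ifP => // ty.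
  by rewrite ger0_norm// subr_ge0 ltW// (lt_trans mut).
rewrite fubini_tonelli//; apply: eq_integral => y _; rewrite /k /b/=.
set c := `|y - mu| * p y.
have -> : (y - mu) ^+ 2 * p y = c * `|y - mu| by rewrite /c -real_normK ?num_real//; ring.
clearbody c; have [ymu|muy] := leP y mu.
  transitivity (\int[lebesgue_measure]_(t in `[y, mu]) c%:E)%E.
    rewrite [RHS]integral_mkcond; apply: eq_integral => t _.
    rewrite patchE mem_setE in_itv/=; case: (leP y t) => //= yt; last first.
      by rewrite andbT ltNge (le_trans (ltW yt) ymu).
    by case: (leP t mu).
  rewrite integral_cst//= lebesgue_measure_itv/= lte_fin EFinM.
  case: ifPn => [_|]; first by rewrite ler0_norm ?subr_le0// opprB -EFinD.
  rewrite -leNgt => muy; have -> : y = mu by apply/eqP; rewrite eq_le ymu.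
  by rewrite subrr normr0.
transitivity (\int[lebesgue_measure]_(t in `]mu, y[) c%:E)%E.
  rewrite [RHS]integral_mkcond; apply: eq_integral => t _.
  rewrite patchE mem_setE in_itv/=; case: (leP t mu) => //= tmu.
    by rewrite orbF andbT leNgt (le_lt_trans tmu muy).
  by rewrite andbF.
rewrite integral_cst//= lebesgue_measure_itv/= lte_fin EFinM muy.
by rewrite gtr0_norm ?subr_gt0// -EFinD.
Qed.

End stein_kernel_bound.

Section finite_expectation.
Variables (R : realType) (P : probability (measurableTypeR R) R) (p : R -> R).
Hypotheses (dp : prob_density p) (Pp : has_density P p) (fP : finite_mean P).

Lemma finite_mean_density :
  lebesgue_measure.-integrable setT (EFin \o (fun y => y * p y)).
Proof. by apply: (integrable_density dp Pp (g := id) _).1 => //; exact: measurable_id. Qed.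

Lemma expectation_Lip1 (h : R -> R) : Lip1 h ->
  ('E_P[h] = (\int[lebesgue_measure]_y (h y * p y))%:E)%E.
Proof.
move=> lh; rewrite (expectation_density dp Pp) ?fineK//; last exact: measurable_Lip1.
apply: integrable_fin_num => //.
exact: (integrable_Lip1 dp finite_mean_density lh).
Qed.

Lemma mean_density : mean P = \int[lebesgue_measure]_y (y * p y).
Proof. by rewrite /mean (expectation_Lip1 (@Lip1_id R)). Qed.

End finite_expectation.

(** * The Stein identity and the Wasserstein bounds *)

Section stein_comparison.
Variables (R : realType) (P1 P2 : probability (measurableTypeR R) R).
Variables (p q rho : R -> R) (c : R) (a1 b1 a2 b2 : \bar R).
Hypotheses (dp : prob_density p) (dq : prob_density q).
Hypotheses (sp : support_itv p a1 b1) (sq : support_itv q a2 b2).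
Hypotheses (Pp : has_density P1 p) (Pq : has_density P2 q).
Hypotheses (I21 : eitv a2 b2 `<=` eitv a1 b1).
Hypotheses (fP1 : finite_mean P1) (fP2 : finite_mean P2).
Hypotheses (c0 : 0 < c) (rhopq : forall t, rho t * p t = c * q t).
Hypotheses (mrho : measurable_fun setT rho).
Hypotheses (drho : forall t, eitv a2 b2 t -> derivable rho t 1).

Let G (h : R -> R) (t : R) := rho t * centered_primitive P1 p a1 h t.
Let rho' : R -> R := derive1 rho \_ (eitv a2 b2).

Hypothesis intG : forall h, Lip1 h ->
  lebesgue_measure.-integrable (eitv a2 b2) (EFin \o derive1 (G h)).
Hypothesis limG : forall h, Lip1 h ->
  G h t @[t --> left_end a2] --> 0 /\ G h t @[t --> right_end b2] --> 0.

Let E1 (h : R -> R) := \int[lebesgue_measure]_y (h y * p y).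
Let E2 (h : R -> R) := \int[lebesgue_measure]_y (h y * q y).
Let phi (h : R -> R) (y : R) := (h y - E1 h) * p y.

Let ip1 := finite_mean_density dp Pp fP1.
Let ip2 := finite_mean_density dq Pq fP2.

Let mrho' : measurable_fun setT rho'.
Proof. by apply: measurable_derive1 => //; exact: measurable_eitv. Qed.

Let intphi (h : R -> R) : Lip1 h -> lebesgue_measure.-integrable setT (EFin \o phi h).
Proof. by move=> lh; exact: integrable_Lip1B. Qed.

Let centered_primitiveE (h : R -> R) (t : R) : Lip1 h ->
  centered_primitive P1 p a1 h t = cumul (phi h) t.
Proof.
move=> lh; rewrite -(@Rintegral_eitv_cumul _ _ a1 b1); first last.
- by move=> y ny; rewrite /phi; case: sp => _ _ ->//; rewrite mulr0.
- exact: intphi.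
by apply: eq_Rintegral => y _; rewrite (expectation_Lip1 dp Pp fP1).
Qed.

Let GE (h : R -> R) : Lip1 h -> G h = (fun t => rho t * cumul (phi h) t).
Proof. by move=> lh; apply/funext => t; rewrite /G centered_primitiveE. Qed.

Let psi (h : R -> R) (t : R) := rho' t * cumul (phi h) t.

Let mpsi (h : R -> R) : Lip1 h -> measurable_fun setT (psi h).
Proof. by move=> lh; apply: measurable_funM => //; exact: (measurable_cumul (intphi lh)). Qed.

Let dG (h : R -> R) : R -> R := derive1 (G h) \_ (eitv a2 b2).

Let intdG (h : R -> R) : Lip1 h -> lebesgue_measure.-integrable setT (EFin \o dG h).
Proof.
move=> lh; rewrite /dG -restrict_EFin; apply/integrable_restrict => //=.
  exact: measurable_eitv.
by rewrite setTI; exact: intG.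
Qed.

Let intq (h : R -> R) : Lip1 h ->
  lebesgue_measure.-integrable setT (EFin \o (fun y => c * ((h y - E1 h) * q y))).
Proof. by move=> lh; exact: (integrableZl measurableT c (integrable_Lip1B dq ip2 (E1 h) lh)). Qed.

Let intpsi0 (h : R -> R) : Lip1 h ->
  lebesgue_measure.-integrable setT
    (EFin \o (fun y => dG h y - c * ((h y - E1 h) * q y))).
Proof. by move=> lh; exact: (integrableB measurableT (intdG lh) (intq lh)). Qed.

(** The product rule, with rho p = c q in the second term. Off I2 both sides
    vanish: rho' is extended by 0 and q is 0 there. *)
Let ae_psi (h : R -> R) : Lip1 h ->
  ae_eq lebesgue_measure setT
    (EFin \o psi h) (EFin \o (fun y => dG h y - c * ((h y - E1 h) * q y))).
Proof.
move=> lh; have := ae_derive_cumul (intphi lh).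
apply: filterS; first exact: (ae_filter_ringOfSetsType lebesgue_measure).
move=> t [dF Ft] _ /=; congr EFin.
rewrite /psi /dG /rho' !patchE; case: ifPn => [/set_mem I2t|]; last first.
  by rewrite notin_setE => nt; case: sq => _ _ ->//; rewrite mul0r !mulr0 subr0.
have gE : 'D_1 (G h) t = rho t *: 'D_1 (cumul (phi h)) t + cumul (phi h) t *: 'D_1 rho t.
  by rewrite (GE lh); exact: (deriveM (drho I2t) dF).
rewrite [derive1 (G h) t]derive1E gE -!derive1E Ft /phi /=.
rewrite [_ *: (_ * _)]mulrCA rhopq [cumul _ _ *: _]mulrC.
ring.
Qed.

(** What is assumed integrable is the whole derivative of G h; the part with q is
    integrable because both means are finite, so rho' F_h is as well. *)
Lemma integrable_psi (h : R -> R) : Lip1 h ->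
  lebesgue_measure.-integrable setT (EFin \o psi h).
Proof.
move=> lh; have /integrableP[m0 fin0] := intpsi0 lh.
apply/integrableP; split; first by apply/measurable_EFinP; exact: mpsi.
suff -> : (\int[lebesgue_measure]_t `|(EFin \o psi h) t| =
    \int[lebesgue_measure]_t
      `|(EFin \o (fun y => dG h y - c * ((h y - E1 h) * q y))%R) t|)%E by [].
apply: ae_eq_integral => //.
- by apply: measurableT_comp => //; apply/measurable_EFinP; exact: mpsi.
- exact: measurableT_comp.
- by have := ae_psi lh; apply: filterS => t H /H /= [->].
Qed.

(** The derivative of G h integrates to 0, and (h - E1 h) q integrates to
    E2 h - E1 h. *)
Lemma stein_identity (h : R -> R) : Lip1 h ->
  \int[lebesgue_measure]_t psi h t = c * (E1 h - E2 h).
Proof.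
move=> lh; have [a2b2 _ _] := sq.
have -> : \int[lebesgue_measure]_t psi h t =
    \int[lebesgue_measure]_t (dG h t - c * ((h t - E1 h) * q t)).
  congr fine; apply: ae_eq_integral => //.
  - by apply/measurable_EFinP; exact: mpsi.
  - by case/integrableP : (intpsi0 lh).
  - exact: ae_psi.
rewrite RintegralB//; [|exact: intdG|exact: intq].
have -> : \int[lebesgue_measure]_t dG h t = 0.
  have [la lb] := limG lh.
  apply: (integral_of_vanishing_primitive a2b2 (intdG lh)) la lb.
    by move=> t nt; rewrite /dG patchE memNset.
  move=> s t as_ st tb.
  have I2 r : s <= r <= t -> eitv a2 b2 r.
    move=> /andP[sr rt]; split; first by rewrite (lt_le_trans as_)// lee_fin.
    by rewrite (le_lt_trans _ tb)// lee_fin.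
  rewrite (GE lh); apply: product_cumul_FTC => //; first exact: intphi.
  - exact: intdG.
  - by move=> r /I2; exact: drho.
  - by move=> r /I2 I2r; rewrite -(GE lh) /dG patchE mem_set.
have inthq := integrable_Lip1 dq ip2 lh.
have intqq := prob_density_integrable dq.
have q1 : \int[lebesgue_measure]_t q t = 1 by rewrite /Rintegral; case: dq => _ _ ->.
rewrite RintegralZl//; last exact: (integrable_Lip1B dq ip2 (E1 h) lh).
under eq_Rintegral do rewrite mulrBl.
rewrite RintegralB//; last exact: (integrableZl measurableT (E1 h) intqq).
rewrite RintegralZl// q1 -/(E2 h); ring.
Qed.

Let K := cumul (fun y => (E1 id - y) * p y).
Let tau := stein_kernel p a1 (mean P1).

Let KE : K = (fun t => - cumul (phi id) t).
Proof.
apply/funext => t; rewrite /K /cumul -mulN1r -RintegralZl//; last first.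
  apply: integrable_on => //; exact: (intphi (@Lip1_id R)).
by apply: eq_Rintegral => y _; rewrite /phi; ring.
Qed.

Let intK : lebesgue_measure.-integrable setT
  (EFin \o (fun y => (E1 id - y) * p y)).
Proof. exact: integrable_subl. Qed.

Let K_ge0 t : 0 <= K t.
Proof. exact: le_trans (normr_ge0 _) (cumul_Lip1_le dp ip1 t (@Lip1_id R)). Qed.

Let mK : measurable_fun setT K. Proof. exact: measurable_cumul. Qed.

Let tauE : tau = (fun t => (p t)^-1 * K t).
Proof.
apply/funext => t; rewrite /tau /stein_kernel (mean_density dp Pp fP1).
rewrite (@Rintegral_eitv_cumul _ _ a1 b1)// => y ny.
by case: sp => _ _ ->//; rewrite mulr0.
Qed.

Let mtau : measurable_fun setT tau.
Proof.
rewrite tauE; apply: measurable_funM => //.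
by apply: measurable_inv_ge0; case: dp.
Qed.

Let tau_p t : eitv a1 b1 t -> tau t * p t = K t.
Proof.
move=> I1t; have [_ p0 _] := sp.
by rewrite tauE mulrAC mulVf ?mul1r// gt_eqF// p0.
Qed.

(** The identity tau p = K is available on I1 only; off I1 the factor rho'
    vanishes, because I2 is contained in I1. *)
Let tau_rho' (g : R -> R) t : tau t * (g (rho' t)) * p t = g (rho' t) * K t \/ rho' t = 0.
Proof.
have [/I21 I1t|nt] := pselect (eitv a2 b2 t).
  by left; rewrite mulrAC tau_p// mulrC.
by right; rewrite /rho' patchE memNset.
Qed.

Lemma expectation_rho : ('E_P1[rho] = c%:E)%E.
Proof.
rewrite (expectation_density dp Pp)//; have [mq q0 q1] := dq.
under eq_integral do rewrite rhopq EFinM.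
rewrite ge0_integralZl//; first by rewrite q1 mule1.
- exact/measurable_EFinP.
- by move=> t _; rewrite lee_fin.
- by rewrite lee_fin ltW.
Qed.

Lemma expectation_tau_rho' :
  ('E_P1[fun t => (tau t * rho' t)%R] = (c * (E2 id - E1 id))%:E)%E.
Proof.
rewrite (expectation_density dp Pp); last exact: measurable_funM.
have inti := integrable_psi (@Lip1_id R).
have -> : (\int[lebesgue_measure]_t (tau t * rho' t * p t)%:E =
    \int[lebesgue_measure]_t ((-1)%:E * (psi id t)%:E))%E.
  apply: eq_integral => t _; rewrite -EFinM; congr EFin.
  have [->|] := tau_rho' id t; first by rewrite KE /psi; ring.
  by move=> r0; rewrite /psi r0; ring.
rewrite integralZl// -[X in (_ * X)%E]fineK ?integrable_fin_num//.
rewrite -/(Rintegral _ _ _) stein_identity; last exact: Lip1_id.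
by rewrite -EFinM; congr EFin; ring.
Qed.

Lemma mean_difference :
  (`|mean P1 - mean P2|%:E =
   `| 'E_P1[fun t => (tau t * rho' t)%R] | / 'E_P1[rho])%E.
Proof.
rewrite expectation_tau_rho' expectation_rho inver gt_eqF//= -EFinM.
rewrite (mean_density dp Pp fP1) (mean_density dq Pq fP2) -/(E1 id) -/(E2 id).
by rewrite normrM gtr0_norm// mulrAC divff ?mul1r ?gt_eqF// distrC.
Qed.

Lemma mean_difference_le_wasserstein1 :
  (`|mean P1 - mean P2|%:E <= wasserstein1 P1 P2)%E.
Proof.
apply: ereal_sup_ubound; exists id; first exact: Lip1_id.
rewrite (expectation_Lip1 dp Pp fP1 (@Lip1_id R)) (expectation_Lip1 dq Pq fP2 (@Lip1_id R)).
by rewrite (mean_density dp Pp fP1) (mean_density dq Pq fP2) -EFinB.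
Qed.

Let expectation_tau_norm : 'E_P1[fun t => (tau t * `|rho' t|)%R]%E =
  (\int[lebesgue_measure]_t (`|rho' t| * K t)%:E)%E.
Proof.
rewrite (expectation_density dp Pp); last first.
  by apply: measurable_funM => //; exact: measurableT_comp.
apply: eq_integral => t _; congr EFin.
have [//|r0] := tau_rho' (fun u : R => `|u|) t.
by rewrite r0; rewrite normr0; ring.
Qed.

Lemma wasserstein1_le_expectation :
  (wasserstein1 P1 P2
     <= 'E_P1[fun t => (tau t * `|rho' t|)%R] / 'E_P1[rho])%E.
Proof.
apply: ge_ereal_sup => _ [h lh <-].
rewrite (expectation_Lip1 dp Pp fP1 lh) (expectation_Lip1 dq Pq fP2 lh).
rewrite -EFinB/= expectation_rho inver gt_eqF//= expectation_tau_norm.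
rewrite lee_pdivlMr//.
rewrite -EFinM -{1}(gtr0_norm c0) -normrM mulrC -/(E1 h) -/(E2 h) -stein_identity//.
have inti := integrable_psi lh.
apply: (@le_trans _ _ (\int[lebesgue_measure]_t `|(psi h t)%:E|)%E).
  rewrite EFin_normr_Rintegral//; apply: le_abse_integral => //.
  by apply/measurable_EFinP; exact: mpsi.
apply: ge0_le_integral => //.
- by apply: measurableT_comp => //; apply/measurable_EFinP; exact: mpsi.
- by apply/measurable_EFinP; apply: measurable_funM => //; exact: measurableT_comp.
- move=> t _; rewrite lee_fin /psi normrM ler_wpM2l//.
  exact: (cumul_Lip1_le dp ip1 t lh).
Qed.

Lemma expectation_tau_le_variance :
  ('E_P1[fun t => (tau t * `|rho' t|)%R] <=
     inf_norm rho' * 'V_P1[fun t : R => t])%E.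
Proof.
rewrite expectation_tau_norm.
have -> : ('V_P1[fun t : R => t] = \int[lebesgue_measure]_t (K t)%:E)%E.
  rewrite /variance unlock.
  have mE : fine 'E_P1[fun t : R => t]%E = E1 id by rewrite (expectation_Lip1 dp Pp fP1 (@Lip1_id R)).
  rewrite mE.
  rewrite (expectation_density dp Pp); last first.
    by apply: measurable_funM; exact: measurable_funB.
  by rewrite (integral_stein_kernel dp ip1).
have mEK : measurable_fun setT (EFin \o K) by exact/measurable_EFinP.
have n0 : (0 <= inf_norm rho')%E by exact: Lnorm_ge0.
rewrite -ge0_integralZl//; last by move=> t _; rewrite lee_fin.
apply: ae_ge0_le_integral => //.
- by move=> t _; rewrite lee_fin mulr_ge0.
- by apply/measurable_EFinP; apply: measurable_funM => //; exact: measurableT_comp.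
- by move=> t _; rewrite mule_ge0// lee_fin.
- exact: measurable_funeM.
have : \forall t \ae lebesgue_measure, (`|(rho' t)%:E| <= inf_norm rho')%E.
  rewrite /inf_norm unlock.
  case: ifPn => [_|]; first exact: ess_sup_ge.
  by move=> /negP[]; rewrite -set_itvNyy [ltRHS]lebesgue_measure_itv/= ltry.
apply: filterS; first exact: (ae_filter_ringOfSetsType lebesgue_measure).
move=> t le_t _; rewrite EFinM lee_wpmul2r// lee_fin//.
Qed.

Lemma wasserstein1_le_variance :
  (wasserstein1 P1 P2 <= inf_norm rho' * ('V_P1[fun t : R => t] / 'E_P1[rho]))%E.
Proof.
apply: (le_trans wasserstein1_le_expectation).
rewrite muleA lee_wpmul2r ?expectation_tau_le_variance//.
by rewrite expectation_rho inve_ge0 lee_fin ltW.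
Qed.

End stein_comparison.

(** * Posterior distributions *)

(** The likelihood cancels from the ratio of the posterior densities; c is the
    ratio of the normalizing constants, positive because both densities are
    positive at a point of I2. Where p vanishes, q does too. *)
Lemma posterior_prior_ratio (R : realType) (Theta : set R) (p1 p2 ell : R -> R)
  (a1 b1 a2 b2 : \bar R) :
  let p := posterior Theta p1 ell in
  let q := posterior Theta p2 ell in
  (forall t, Theta t -> 0 <= ell t) ->
  nonneg_on Theta p1 -> nonneg_on Theta p2 ->
  support_itv p a1 b1 -> support_itv q a2 b2 -> eitv a2 b2 `<=` eitv a1 b1 ->
  exists2 c : R, 0 < c & forall t, prior_ratio p1 p2 a1 b1 t * p t = c * q t.
Proof.
move=> p q ell0 p10 p20 [_ p_gt0 p_off] [a2b2 q_gt0 q_off] I21.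
set k1 := norm_const Theta p1 ell; set k2 := norm_const Theta p2 ell.
have pE t : eitv a1 b1 t -> [/\ Theta t, p t = k1 * p1 t * ell t & q t = k2 * p2 t * ell t].
  move=> I1t; have := p_gt0 _ I1t; rewrite /p /q /posterior !patchE.
  by case: ifPn; [move=> /set_mem|rewrite ltxx].
have [t0 I2t0] := eitv_nonempty a2b2.
have [Tt0 pt0 qt0] := pE _ (I21 _ I2t0).
have pos (k u v : R) : 0 <= u -> 0 <= v -> 0 < k * u * v -> 0 < k.
  move=> u0 v0 kuv; rewrite ltNge; apply/negP => k0.
  by move: kuv; rewrite ltNge -mulrA mulr_le0_ge0// mulr_ge0.
have k10 : 0 < k1.
  have := p_gt0 _ (I21 _ I2t0); rewrite pt0; apply: pos; [exact: p10|exact: ell0].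
have k20 : 0 < k2.
  have := q_gt0 _ I2t0; rewrite qt0; apply: pos; [exact: p20|exact: ell0].
exists (k1 / k2) => [|t]; first exact: divr_gt0.
have [I1t|nt] := pselect (eitv a1 b1 t); last first.
  by rewrite p_off// q_off ?mulr0// => /I21.
have [Tt pt qt] := pE _ I1t.
have p1t : p1 t != 0.
  by apply: contraPneq (p_gt0 _ I1t); rewrite pt => ->; rewrite mulr0 mul0r ltxx.
have k2n : k2 != 0 by rewrite gt_eqF.
rewrite /prior_ratio patchE mem_set// pt qt.
by field; rewrite p1t k2n.
Qed.

Theorem theorem1 (R : realType) (dX : measure_display) (X : measurableType dX)
  (nu : {measure set X -> \bar R}) (Theta : set R) (f : R -> X -> R)
  (n : nat) (x : 'I_n -> X) (p1 p2 : R -> R)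
  (P1 P2 : probability (measurableTypeR R) R) (a1 b1 a2 b2 : \bar R) :
  let ell := likelihood f x in
  let p1x := posterior Theta p1 ell in
  let p2x := posterior Theta p2 ell in
  let I1 := eitv a1 b1 in
  let I2 := eitv a2 b2 in
  let mu1 := mean P1 in
  let mu2 := mean P2 in
  let rho := prior_ratio p1 p2 a1 b1 in
  let rho' : R -> R := derive1 rho \_ I2 in
  let tau1 := stein_kernel p1x a1 mu1 in
  let G := fun (h : R -> R) (t : R) =>
    rho t * centered_primitive P1 p1x a1 h t in
  sampling_densities nu Theta f ->
  nonneg_on Theta p1 -> nonneg_on Theta p2 ->
  prob_density p1x -> prob_density p2x ->
  support_itv p1x a1 b1 -> support_itv p2x a2 b2 ->
  has_density P1 p1x -> has_density P2 p2x ->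
  I2 `<=` I1 ->
  finite_mean P1 -> finite_mean P2 ->
  (forall t, I2 t -> derivable rho t 1) ->
  ('E_P1[fun t : R => (`|t - mu1| * rho t)%R] < +oo)%E ->
  (forall h, Lip1 h ->
    lebesgue_measure.-integrable I2 (EFin \o derive1 (G h))) ->
  (forall h, Lip1 h ->
    G h t @[t --> left_end a2] --> 0 /\ G h t @[t --> right_end b2] --> 0) ->
  [/\ (`|mu1 - mu2|%:E
         = `| 'E_P1[fun t : R => (tau1 t * rho' t)%R] | / 'E_P1[rho])%E,
      (`| 'E_P1[fun t : R => (tau1 t * rho' t)%R] | / 'E_P1[rho]
         <= wasserstein1 P1 P2)%E,
      (wasserstein1 P1 P2
         <= 'E_P1[fun t : R => (tau1 t * `|rho' t|)%R] / 'E_P1[rho])%E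
    & ('V_P1[fun t : R => t] < +oo)%E ->
      (`|mu1 - mu2|%:E <= wasserstein1 P1 P2)%E /\
      (wasserstein1 P1 P2
         <= inf_norm rho' * ('V_P1[fun t : R => t] / 'E_P1[rho]))%E].
Proof.
move=> ell p1x p2x I1 I2 mu1 mu2 rho rho' tau1 G fdens p10 p20 dp dq sp sq Pp Pq
  I21 fP1 fP2 drho _ intG limG.
have ell0 t : Theta t -> 0 <= ell t.
  by move=> Tt; apply: prodr_ge0 => j _; have [_ ->] := fdens t Tt.
have [c c0 rhopq] := posterior_prior_ratio ell0 p10 p20 sp sq I21.
have mrho : measurable_fun setT rho.
  have [mp p_ge0 _] := dp; have [mq _ _] := dq.
  have -> : rho = (fun t => c * p2x t * (p1x t)^-1).
    apply/funext => t; have [I1t|nt] := pselect (I1 t).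
      have [_ p_gt0 _] := sp.
      by rewrite -rhopq mulfK// gt_eqF// p_gt0.
    have [_ _ p_off] := sp.
    by rewrite p_off// invr0 mulr0 /rho /prior_ratio patchE memNset.
  apply: measurable_funM; first exact: measurable_funM.
  exact: measurable_inv_ge0.
have eq1 := mean_difference dp dq sp sq Pp Pq I21 fP1 fP2 c0 rhopq mrho drho intG limG.
have le1 := mean_difference_le_wasserstein1 dp dq Pp Pq fP1 fP2.
split.
- exact: eq1.
- by rewrite -eq1.
- exact: (wasserstein1_le_expectation dp dq sp sq Pp Pq I21 fP1 fP2 c0 rhopq mrho drho intG limG).
- move=> _; split => //.
  exact: (wasserstein1_le_variance dp dq sp sq Pp Pq I21 fP1 fP2 c0 rhopq mrho drho intG limG).
Qed.
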